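(* Let $1<p,q<\infty$ with $\frac1p+\frac1q=1$ and $p>2$. Then the function $$f(z)=\frac{1}{(1-z)\log\left(\frac{e}{1-z}\right)},\qquad z\in\mathbb D,$$ belongs to the analytic tent space $AT^q_p$.
   Context: $\mathbb D$ is the open unit disc of $\mathbb C$, $\mathbb T$ the unit circle, $dA$ the normalized area Lebesgue measure on $\mathbb D$, $|d\xi|$ arc length on $\mathbb T$; $\log$ is the principal branch. For $\xi\in\mathbb T$ put $$\Gamma_{1/2}(\xi)=\{z\in\mathbb D:|z|<1/2\}\cup\bigcup_{|z|<1/2}[z,\xi),$$ where $[z,\xi)$ is the half-open line segment from $z$ to $\xi$. For $1<p,q<\infty$, $AT^q_p$ is the space of analytic functions $f$ on $\mathbb D$ such that $$\|f\|_{AT^q_p}=\left\{\int_{\mathbb T}\left(\int_{\Gamma_{1/2}(\xi)}|f(z)|^p\,\frac{dA(z)}{1-|z|^2}\right)^{q/p}|d\xi|\right\}^{1/q}<\infty.$$ *)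

(* Defs.v *)
(* R[i] and its notations come from the file [complex] of mathcomp-real-closed. *)
From HB Require Import structures.
From mathcomp Require Import all_boot all_order all_algebra.
From mathcomp Require Import complex.
From mathcomp Require Import all_classical all_reals all_analysis.

Set Implicit Arguments.
Unset Strict Implicit.
Unset Printing Implicit Defensive.

Import Order.TTheory GRing.Theory Num.Theory.
Import numFieldNormedType.Exports.
Import Normc.

Local Open Scope classical_set_scope.
Local Open Scope ring_scope.
Local Open Scope complex_scope.

Section tent_spaces.
Context {R : realType}.
Local Notation C := R[i].

(* Note that the library's [normc] is R-valued, unlike `|z| : R[i]. *)
Definition disc (r : R) : set C := [set z | normc z < r].

(* Argument in ]-pi, pi]; the value at 0 is irrelevant. *)
Definition carg (z : C) : R :=
  if 0 <= complex.Im z then acos (complex.Re z / normc z)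
  else - acos (complex.Re z / normc z).

Definition clog (z : C) : C := ln (normc z) +i* carg z.

(* Complex differentiability at every point of U, C being a normed module over
   itself: the difference quotients h^-1 *: (f (z + h) - f z), h : C, have a
   limit as h tends to 0. For open U this is analyticity on U. *)
Definition analytic_on (U : set C) (f : C -> C) : Prop :=
  forall z, U z -> derivable (f : C^o -> C^o) z 1.

(* The half-open segment [a, b). *)
Definition segment_co (a b : C) : set C :=
  [set (1 - t%:C) * a + t%:C * b | t in `[0, 1[%classic].

Definition Gamma_half (xi : C) : set C :=
  disc 2^-1 `|` \bigcup_(z in disc 2^-1) segment_co z xi.

Lemma pi_inv_ge0 : 0 <= pi^-1 :> R.
Proof. by rewrite invr_ge0 pi_ge0. Qed.

(* dA = pi^-1 dx dy, for which the unit disc has measure 1; the point (x, y) of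
   R * R stands for x +i* y. *)
Definition area : {measure set (measurableTypeR R * measurableTypeR R) -> \bar R} :=
  mscale (NngNum pi_inv_ge0) (lebesgue_measure \x lebesgue_measure)%E.

Definition tent_integral (p : R) (f : C -> C) (xi : C) : \bar R :=
  (\int[area]_(w in [set w | Gamma_half xi (w.1 +i* w.2)])
     (normc (f (w.1 +i* w.2)) `^ p / (1 - normc (w.1 +i* w.2) ^+ 2))%:E)%E.

(* Arc length on the unit circle is Lebesgue measure in the angle t. *)
Definition tent_norm (q p : R) (f : C -> C) : \bar R :=
  ((\int[lebesgue_measure]_(t in `[0%R, (pi *+ 2)%R[%classic)
      tent_integral p f (cos t +i* sin t) `^ (q / p)) `^ q^-1)%E.

(* Only the values of f on the unit disc matter. *)
Definition analytic_tent (q p : R) : set (C -> C) :=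
  [set f | analytic_on (disc 1) f /\ (tent_norm q p f < +oo)%E].

End tent_spaces.

(* Main.v *)
(** On the cone [Gamma(xi)] with vertex [xi = e^(it)] one has
    [|z - xi| <= 3 (1 - |z|)], so that [|1 - z|] dominates both [|z - xi| / 3]
    and [a = min(t, 2 pi - t) / 12].  Put [L(x) = 1 - ln x].  Since
    [|f(z)| <= 1 / (b L(b))] for [b = |1 - z|], and since [L] varies slowly,
    [|f(z)|^p <= C a^(2-p) L(a)^(-p) b^(-2)].  The integral over the cone of
    [b^(-2) / (1 - |z|^2)] is [O(1/a)]: in the Cartesian coordinates centred at
    [xi] the integrand is bounded by a product of two functions of one variable
    with explicit antiderivatives.  Hence the inner integral is
    [O(a^(1-p) L(a)^(-p))]; its power [q/p] is [O(a^(-1) L(a)^(-q))], because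
    [(1-p) q/p = -1], and this is integrable at [0] because [q > 1].

    For analyticity, [log (e / (1 - z)) = 1 - ln (x^2 + y^2) / 2 + i atan (y / x)]
    with [x = 1 - Re z > 0] and [y = Im z], whose complex difference quotients
    are controlled by the real derivatives of [ln] and [atan]. *)
Require Import Defs.
From mathcomp Require Import all_boot all_order all_algebra.
From mathcomp Require Import complex.
From mathcomp Require Import all_classical all_reals all_analysis.
From mathcomp Require Import measurable_realfun.
From mathcomp Require Import ring lra.

Import Order.TTheory GRing.Theory Num.Theory.
Import numFieldNormedType.Exports.
Import Normc.
Local Open Scope classical_set_scope.
Local Open Scope ring_scope.
Local Open Scope complex_scope.

Set Implicit Arguments.
Unset Strict Implicit.
Unset Printing Implicit Defensive.

(** * Tools for nonnegative and improper integrals *)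

(* No measurability is assumed: for nonnegative functions the integral is a
   supremum over the simple functions below, hence monotone. *)
Lemma ge0_le_integral_subset d (T : measurableType d) (R : realType)
    (mu : {measure set T -> \bar R}) (D E : set T) (f g : T -> \bar R) :
  D `<=` E -> (forall x, D x -> (0 <= f x <= g x)%E) ->
  (forall x, E x -> (0 <= g x)%E) ->
  (\int[mu]_(x in D) f x <= \int[mu]_(x in E) g x)%E.
Proof.
move=> DE fg g0; rewrite (integral_mkcond D) (integral_mkcond E).
have f0 x : (0 <= (f \_ D) x)%E.
  by apply: erestrict_ge0 => y /fg/andP[].
have g0' x : (0 <= (g \_ E) x)%E by exact: erestrict_ge0.
rewrite !ge0_integralTE//; apply: le_ereal_sup => _ [h /= hf <-].
exists h => //= x; apply: (le_trans (hf x)).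
rewrite /patch; case: ifPn => [xD|_]; last exact: g0'.
by move/set_mem: xD => xD; rewrite (mem_set (DE _ xD)); case/andP: (fg _ xD).
Qed.

(** Monotone convergence along the growing compact intervals reduces the improper integral to the
    fundamental theorem of calculus on each of them, so a uniform bound on the increments of the
    primitive suffices. *)
Lemma integral_antideriv_le (R : realType) (f F : R -> R) (u v : R^nat) (M : R) :
  (forall n, u n < v n) ->
  nonincreasing_seq u -> nondecreasing_seq v ->
  (forall n x, u n <= x <= v n ->
    [/\ 0 <= f x, {for x, continuous f} & is_derive x 1 F (f x)]) ->
  (forall n, F (v n) - F (u n) <= M) ->
  (\int[lebesgue_measure]_(x in \bigcup_n `[u n, v n]%classic) (f x)%:E <= M%:E)%E.
Proof.
move=> uv du iv fF FM.
have mf n : measurable_fun `[u n, v n]%classic f.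
  apply: subspace_continuous_measurable_fun => //.
  apply: continuous_in_subspaceT => x; rewrite inE/= in_itv/= => xn.
  by have [] := fF n x xn.
have cvg_n : (\int[lebesgue_measure]_(x in `[u n, v n]) (f x)%:E)%E @[n --> \oo]
    --> (\int[lebesgue_measure]_(x in \bigcup_n `[u n, v n]%classic) (f x)%:E)%E.
  apply: ge0_nondecreasing_set_cvg_integral => //.
  - move=> m n mn; rewrite subsetEset => x /=; rewrite !in_itv/= => /andP[ux xv].
    by rewrite (le_trans (du _ _ mn) ux) (le_trans xv (iv _ _ mn)).
  - by move=> n; apply/measurable_EFinP; exact: mf.
  - by move=> n x /=; rewrite in_itv/= => /fF[]; rewrite lee_fin.
rewrite -(cvg_lim _ cvg_n)//; apply: lime_le; first by apply/cvg_ex; eexists; exact: cvg_n.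
apply: nearW => n; rewrite (@continuous_FTC2 _ f F)//; last 2 first.
- have cF x : u n <= x <= v n -> {for x, continuous F}.
    by move=> /fF[_ _ [dF _]]; exact/differentiable_continuous/derivable1_diffP.
  split.
  + by move=> x; rewrite in_itv/= => /andP[/ltW ux /ltW xv]; have [|] := fF n x; rewrite ?ux.
  + by apply: cvg_at_right_filter; apply: cF; rewrite lexx ltW.
  + by apply: cvg_at_left_filter; apply: cF; rewrite lexx ltW.
- move=> x; rewrite in_itv/= => /andP[/ltW ux /ltW xv].
  by have [|_ _ dF] := fF n x; rewrite ?ux// derive1E derive_val.
- by rewrite -EFinB lee_fin.
- apply: continuous_in_subspaceT => x; rewrite inE/= in_itv/= => xn.
  by have [] := fF n x xn.
Qed.

Lemma measurable_pinfty_point (R : realType) (f : R -> R) (D : set R) (c : R) :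
  open D -> ~ D c -> {in D, continuous f} ->
  measurable_fun (c |` D) (fun x => if x == c then +oo else (f x)%:E)%E.
Proof.
move=> oD Dc cf; have mD : measurable D by exact: open_measurable.
rewrite measurable_funU//; split; first exact: measurable_fun_set1.
apply: (eq_measurable_fun (EFin \o f)) => [x /set_mem Dx|].
  by case: eqP => // xc; rewrite xc in Dx.
by apply/measurable_EFinP; exact: open_continuous_measurable_fun.
Qed.

(** A single point is null, so the value [+oo] there costs nothing; it lets a bound hold at a
    singularity, where division by zero would return 0. *)
Lemma integral_pinfty_point (R : realType) (f : R -> R) (D : set R) (c : R) :
  open D -> ~ D c -> {in D, continuous f} -> (forall x, D x -> 0 <= f x) ->
  (\int[lebesgue_measure]_(x in c |` D)
     (if x == c then +oo else (f x)%:E) =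
   \int[lebesgue_measure]_(x in D) (f x)%:E)%E.
Proof.
move=> oD Dc cf f0; have mD : measurable D by exact: open_measurable.
have hE x : D x -> (if x == c then +oo else (f x)%:E)%E = (f x)%:E.
  by case: eqP => // ->.
rewrite ge0_integral_setU//.
- rewrite integral_set1 add0e; apply: eq_integral => x /set_mem; exact: hE.
- exact: measurable_pinfty_point.
- by move=> x [->|Dx]; rewrite ?eqxx ?hE ?lee_fin ?f0// leey.
- by apply/disj_setPS => x /= [-> ?]; exact: Dc.
Qed.

(** * The one-variable kernel and its integral over the line *)

(** Of order [u^(-1/2)] at 0 and [u^(-3/2)] at infinity, hence integrable, with the explicit
    primitive [-2 / (sqrt u + sqrt a)]. *)
Definition kernel (R : realType) (a u : R) : R :=
  (Num.sqrt u)^-1 * (Num.sqrt u + Num.sqrt a) ^- 2.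

Lemma kernel_gt0 (R : realType) (a u : R) : 0 < a -> 0 < u -> 0 < kernel a u.
Proof.
move=> a0 u0; rewrite mulr_gt0 ?invr_gt0 ?sqrtr_gt0// exprn_gt0//.
by rewrite addr_gt0 ?sqrtr_gt0.
Qed.

Lemma is_derive_kernel (R : realType) (a u : R) : 0 < a -> 0 < u ->
  is_derive u 1 (fun v => - 2 * (Num.sqrt v + Num.sqrt a)^-1) (kernel a u).
Proof.
move=> a0 u0; have su : 0 < Num.sqrt u by rewrite sqrtr_gt0.
have sa : 0 < Num.sqrt a by rewrite sqrtr_gt0.
have sua : Num.sqrt u + Num.sqrt a != 0 by rewrite gt_eqF ?addr_gt0.
have d1 : is_derive u 1 (fun v => Num.sqrt v + Num.sqrt a) (2 * Num.sqrt u)^-1.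
  have := is_deriveD (is_derive1_sqrt u0) (is_derive_cst (Num.sqrt a) u 1).
  by rewrite addr0.
have d2 := @is_deriveV _ (fun v => Num.sqrt v + Num.sqrt a) u _ 1 sua d1.
apply: (is_derive_eq (is_deriveZ (- 2) d2)).
rewrite /kernel /GRing.scale/=.
by field; rewrite sua gt_eqF.
Qed.

Lemma continuous_kernel (R : realType) (a c x : R) : 0 < a -> x != c ->
  {for x, continuous (fun y => kernel a `|y - c|)}.
Proof.
move=> a0 xc; have sa : 0 < Num.sqrt a by rewrite sqrtr_gt0.
have xc0 : 0 < `|x - c| by rewrite normr_gt0 subr_eq0.
have cs : Num.sqrt `|y - c| @[y --> x] --> Num.sqrt `|x - c|.
  apply: (@continuous_comp _ _ _ (fun y => `|y - c|) Num.sqrt); last exact: sqrt_continuous.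
  by apply: cvg_norm; apply: cvgB; [exact: cvg_id|exact: cvg_cst].
rewrite /continuous_at /kernel; apply: cvgM.
  by apply: cvgV => //; rewrite sqrtr_eq0 -ltNge.
have sua : Num.sqrt `|x - c| + Num.sqrt a != 0.
  by rewrite gt_eqF// ltr_wpDl ?sqrtr_ge0.
apply: cvgV; first by rewrite expf_neq0.
apply: cvgM; apply: cvgD => //; exact: cvg_cst.
Qed.

(** Exhausts the ray by compact intervals that avoid the singular endpoint [c], in the form that
    [integral_antideriv_le] takes. *)
Lemma bigcup_itv_right (R : realType) (c : R) :
  [set x | c < x] = \bigcup_n `[c + n.+1%:R^-1, c + n.+2%:R]%classic.
Proof.
apply/seteqP; split=> [x /= cx|x [n _] /=]; last first.
  by rewrite in_itv/= => /andP[+ _]; apply: lt_le_trans; rewrite ltrDl invr_gt0.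
have xc : 0 < x - c by rewrite subr_gt0.
(* Adding the two truncations makes one index large enough for both endpoints. *)
pose n := (Num.truncn (x - c)^-1 + Num.truncn (x - c))%N.
exists n => //=; rewrite in_itv/=; apply/andP; split.
  rewrite addrC -lerBrDr -[leRHS]invrK lef_pV2 ?posrE ?invr_gt0//.
  apply/ltW/(lt_le_trans (truncnS_gt _)).
  by rewrite ler_nat ltnS leq_addr.
rewrite -lerBlDl; apply/ltW/(lt_le_trans (truncnS_gt _)).
by rewrite ler_nat ltnS leqW// leq_addl.
Qed.

Lemma bigcup_itv_left (R : realType) (c : R) :
  [set x | x < c] = \bigcup_n `[c - n.+2%:R, c - n.+1%:R^-1]%classic.
Proof.
apply/seteqP; split=> [x /= cx|x [n _] /=]; last first.
  by rewrite in_itv/= => /andP[_]; move=> /le_lt_trans; apply; rewrite ltrBlDr ltrDl invr_gt0.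
have : [set y : R | - c < y] (- x) by rewrite /= ltrN2.
rewrite bigcup_itv_right => -[n _] /=; rewrite in_itv/= => /andP[n1 n2].
exists n => //=; rewrite in_itv/=.
by rewrite -lerN2 opprB addrC n2 -lerN2 opprB addrC n1.
Qed.

(* The value +oo at the singularity keeps [ekernel] an upper bound there,
   whereas [kernel a 0 = 0] because [0^-1 = 0]. *)
Definition ekernel (R : realType) (a c x : R) : \bar R :=
  if x == c then +oo%E else (kernel a `|x - c|)%:E.

Lemma ekernel_ge0 (R : realType) (a c x : R) : (0 <= ekernel a c x)%E.
Proof.
rewrite /ekernel; case: eqP => // _.
by rewrite lee_fin mulr_ge0 ?invr_ge0 ?exprn_ge0 ?addr_ge0 ?sqrtr_ge0.
Qed.

Lemma setT_point_rays (R : realType) (c : R) :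
  [set: R] = c |` ([set x | c < x] `|` [set x | x < c]).
Proof.
apply/seteqP; split => // x _.
by case: (ltgtP x c) => xc; [right; right|right; left|left].
Qed.

Lemma open_rays (R : realType) (c : R) :
  open ([set x : R | c < x] `|` [set x | x < c]).
Proof. by apply: openU; [exact: open_gt|exact: open_lt]. Qed.

Lemma continuous_kernel_rays (R : realType) (a c : R) : 0 < a ->
  {in [set x : R | c < x] `|` [set x | x < c],
    continuous (fun x => kernel a `|x - c|)}.
Proof.
move=> a0 x /set_mem[]/= xc; apply: continuous_kernel => //.
  by rewrite gt_eqF.
by rewrite lt_eqF.
Qed.

Lemma measurable_ekernel (R : realType) (a c : R) : 0 < a ->
  measurable_fun setT (ekernel a c).
Proof.
move=> a0; rewrite (setT_point_rays c); apply: measurable_pinfty_point.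
- exact: open_rays.
- by move=> [] /=; rewrite ltxx.
- exact: continuous_kernel_rays.
Qed.

(** Each of the two rays from [c] contributes at most [2 / sqrt a], since the primitive
    [-2 / (sqrt u + sqrt a)] rises from [-2 / sqrt a] towards 0. *)
Lemma integral_kernel_le (R : realType) (a c : R) : 0 < a ->
  (\int[lebesgue_measure]_x
     ekernel a c x <= (4 / Num.sqrt a)%:E)%E.
Proof.
move=> a0; have sa : 0 < Num.sqrt a by rewrite sqrtr_gt0.
have inv_le (n : nat) : (n.+1%:R : R)^-1 <= 1 by rewrite invf_le1 ?ltr0n ?ler1n.
have inv_lt (n : nat) : (n.+1%:R : R)^-1 < n.+2%:R.
  by apply: (le_lt_trans (inv_le n)); rewrite ltr1n.
have bnd v w : 0 <= v -> 0 <= w ->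
    - 2 * (Num.sqrt v + Num.sqrt a)^-1 - - 2 * (Num.sqrt w + Num.sqrt a)^-1
    <= 2 / Num.sqrt a.
  move=> v0 w0; have sv := sqrtr_ge0 v; have sw := sqrtr_ge0 w.
  have : 0 <= (Num.sqrt v + Num.sqrt a)^-1 by rewrite invr_ge0 addr_ge0// ltW.
  have : (Num.sqrt w + Num.sqrt a)^-1 <= (Num.sqrt a)^-1.
    by rewrite lef_pV2 ?posrE ?ltr_wpDl// lerDr.
  lra.
have rgt : (\int[lebesgue_measure]_(x in [set x | (c < x)%R])
    (kernel a `|x - c|)%:E <= (2 / Num.sqrt a)%:E)%E.
  rewrite bigcup_itv_right.
  apply: (@integral_antideriv_le _ _
    (fun x => - 2 * (Num.sqrt (x - c) + Num.sqrt a)^-1)).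
  - by move=> n; rewrite ltrD2l; exact: inv_lt.
  - by move=> m n mn; rewrite lerD2l lef_pV2 ?posrE// ler_nat ltnS.
  - by move=> m n mn; rewrite lerD2l ler_nat !ltnS.
  - move=> n x /andP[cx _]; have xc : 0 < x - c.
      by rewrite subr_gt0; apply: lt_le_trans cx; rewrite ltrDl invr_gt0.
    rewrite gtr0_norm//; split; first exact/ltW/kernel_gt0.
      by apply: continuous_kernel; rewrite // -subr_eq0 gt_eqF.
    have dB : is_derive x 1 (fun y => y - c) 1.
      by have := is_deriveB (is_derive_id x 1) (is_derive_cst c x 1); rewrite subr0.
    have := @is_derive1_comp _ _ (fun y => y - c) _ _ _ (is_derive_kernel a0 xc) dB.
    by rewrite mulr1.
  - move=> n; apply: bnd; first by rewrite addrAC subrr add0r.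
    by rewrite addrAC subrr add0r invr_ge0.
have lft : (\int[lebesgue_measure]_(x in [set x | (x < c)%R])
    (kernel a `|x - c|)%:E <= (2 / Num.sqrt a)%:E)%E.
  rewrite bigcup_itv_left.
  apply: (@integral_antideriv_le _ _
    (fun x => - (- 2 * (Num.sqrt (c - x) + Num.sqrt a)^-1))).
  - by move=> n; rewrite ltrD2l ltrN2; exact: inv_lt.
  - by move=> m n mn; rewrite lerD2l lerN2 ler_nat !ltnS.
  - by move=> m n mn; rewrite lerD2l lerN2 lef_pV2 ?posrE// ler_nat ltnS.
  - move=> n x /andP[_ cx]; have xc : 0 < c - x.
      rewrite subr_gt0; apply: le_lt_trans cx _.
      by rewrite ltrBlDr ltrDl invr_gt0.
    split; first by apply/ltW/kernel_gt0; rewrite // distrC gtr0_norm.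
      by apply: continuous_kernel; rewrite // -subr_eq0 -oppr_eq0 opprB gt_eqF.
    have dB : is_derive x 1 (fun y => c - y) (- 1).
      by have := is_deriveB (is_derive_cst c x 1) (is_derive_id x 1); rewrite sub0r.
    have := is_deriveN
      (@is_derive1_comp _ _ (fun y => c - y) _ _ _ (is_derive_kernel a0 xc) dB).
    by rewrite mulrN1 opprK distrC gtr0_norm.
  - move=> n; rewrite opprK addrC; apply: bnd.
      by rewrite opprB addrC subrK.
    by rewrite opprB addrC subrK invr_ge0.
have f0 x : ([set x : R | c < x] `|` [set x | x < c]) x -> 0 <= kernel a `|x - c|.
  by move=> [] /= xc; apply/ltW/kernel_gt0; rewrite // normr_gt0 subr_eq0 ?(gt_eqF xc) ?(lt_eqF xc).
rewrite (setT_point_rays c) integral_pinfty_point//; last 3 first.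
- exact: open_rays.
- by move=> [] /=; rewrite ltxx.
- exact: continuous_kernel_rays.
rewrite ge0_integral_setU//.
- rewrite (_ : 4 / _ = 2 / Num.sqrt a + 2 / Num.sqrt a) ?EFinD ?leeD//.
  by rewrite -mulrDl -natrD.
- by apply: open_measurable; exact: open_gt.
- by apply: open_measurable; exact: open_lt.
- by apply/measurable_EFinP; exact: (open_continuous_measurable_fun (@open_rays _ c) (@continuous_kernel_rays _ _ _ a0)).
- by apply/disj_setPS => x /= [/lt_trans h /h]; rewrite ltxx.
Qed.

(** * Domination by a product of two kernels, and its area integral *)

Lemma le_kernel (R : realType) (a u v : R) : 0 < a -> 0 < u -> u <= v ->
  kernel a v <= kernel a u.
Proof.
move=> a0 u0 uv; have v0 := lt_le_trans u0 uv.
have su : 0 < Num.sqrt u by rewrite sqrtr_gt0.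
have sv : 0 < Num.sqrt v by rewrite sqrtr_gt0.
have sa : 0 < Num.sqrt a by rewrite sqrtr_gt0.
have suv : Num.sqrt u <= Num.sqrt v by rewrite ler_wsqrtr.
have sua : 0 < Num.sqrt u + Num.sqrt a by rewrite addr_gt0.
have sva : 0 < Num.sqrt v + Num.sqrt a by rewrite addr_gt0.
apply: ler_pM.
- by rewrite invr_ge0 ltW.
- by rewrite invr_ge0 exprn_ge0// ltW.
- by rewrite lef_pV2.
- rewrite lef_pV2 ?posrE ?exprn_gt0//.
  by rewrite lerXn2r ?nnegrE ?(ltW sua) ?(ltW sva)// lerD2r.
Qed.

(* Here [r = |z - xi|], [u] and [v] are its coordinates, [b = |1 - z|] and
   [s = 1 - |z|^2]. *)
Lemma kernel_bound (R : realType) (a b r s u v : R) :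
  0 < a -> 0 < u -> 0 < v -> u <= r -> v <= r ->
  a <= b -> r <= 3 * b -> r <= 3 * s ->
  b ^- 2 / s <= 192 * (kernel a u * kernel a v).
Proof.
move=> a0 u0 v0 ur vr ab rb rs.
have r0 := lt_le_trans u0 ur; have b0 := lt_le_trans a0 ab.
have s0 : 0 < s by rewrite -(@pmulr_rgt0 _ 3)// (lt_le_trans r0).
(* The kernel decreases, so both coordinates may be replaced by [r], which is at least as large. *)
apply: (@le_trans _ _ (192 * (kernel a r * kernel a r))); last first.
  by rewrite ler_pM2l// ler_pM ?le_kernel ?(ltW (kernel_gt0 a0 r0)).
have sr : 0 < Num.sqrt r by rewrite sqrtr_gt0.
have sa : 0 < Num.sqrt a by rewrite sqrtr_gt0.
rewrite /kernel; set t := Num.sqrt r + Num.sqrt a.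
have t0 : 0 < t by rewrite addr_gt0.
(* [t^2 <= 2 (r + a) <= 2 (3 b + b)]. The constant 192 is [8^2] times 3, the factor 3 coming from
   [r <= 3 s]. *)
have tb : t ^+ 2 <= 8 * b.
  have := sqr_sqrtr (ltW r0); have := sqr_sqrtr (ltW a0); rewrite /t.
  have := sqr_ge0 (Num.sqrt r - Num.sqrt a).
  move: (Num.sqrt r) (Num.sqrt a) => x y; nra.
have -> : 192 * ((Num.sqrt r)^-1 * t ^- 2 * ((Num.sqrt r)^-1 * t ^- 2)) =
    (64 * (t ^+ 2) ^- 2) * (3 / r).
  by rewrite -[X in 3 / X](sqr_sqrtr (ltW r0)); field; rewrite !gt_eqF.
apply: ler_pM; rewrite ?invr_ge0 ?exprn_ge0 ?(ltW b0) ?(ltW s0)//.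
  rewrite -[b ^- 2]mul1r ler_pdivrMr ?exprn_gt0// mulrAC ler_pdivlMr ?exprn_gt0//.
  rewrite mul1r (_ : 64 * b ^+ 2 = (8 * b) ^+ 2); last by ring.
  by rewrite lerXn2r ?nnegrE ?exprn_ge0 ?mulr_ge0 ?(ltW t0) ?(ltW b0).
by rewrite -[s^-1]mul1r ler_pdivrMr// mulrAC ler_pdivlMr// mul1r.
Qed.

(** On the lines [x = c1] and [y = c2] one factor is [+oo] and the other is positive, so the right
    side is [+oo]; elsewhere this is [kernel_bound]. *)
Lemma ekernel_bound (R : realType) (a b r s c1 c2 x y : R) :
  0 < a -> `|x - c1| <= r -> `|y - c2| <= r ->
  a <= b -> r <= 3 * b -> r <= 3 * s ->
  ((b ^- 2 / s)%:E <= 192%:E * (ekernel a c1 x * ekernel a c2 y))%E.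
Proof.
move=> a0 xr yr ab rb rs; rewrite /ekernel.
have pos (z c : R) : z != c -> 0 < `|z - c| by move=> zc; rewrite normr_gt0 subr_eq0.
case: eqVneq => [_|/pos x0]; case: eqVneq => [_|/pos y0].
- by rewrite mulyy gt0_muley ?leey.
- by rewrite gt0_mulye ?lte_fin ?kernel_gt0// gt0_muley ?leey.
- by rewrite gt0_muley ?lte_fin ?kernel_gt0// gt0_muley ?leey.
- by rewrite -!EFinM lee_fin; exact: kernel_bound xr yr ab rb rs.
Qed.

Lemma measurable_ekernel2 (R : realType) (a c1 c2 : R) : 0 < a ->
  measurable_fun [set: measurableTypeR R * measurableTypeR R]
    (fun w => ekernel a c1 w.1 * ekernel a c2 w.2)%E.
Proof.
move=> a0; apply: emeasurable_funM.
  by apply: measurableT_comp (measurable_ekernel c1 a0) _.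
by apply: measurableT_comp (measurable_ekernel c2 a0) _.
Qed.

(** By Tonelli the integral is a product of two line integrals, each at most [4 / sqrt a]; the
    factor [pi^-1] is the normalization of [area]. *)
Lemma integral_area_ekernel_le (R : realType) (a c1 c2 : R) : 0 < a ->
  (\int[area]_w (ekernel a c1 w.1 * ekernel a c2 w.2) <= (16 / (pi * a))%:E)%E.
Proof.
move=> a0; have h0 := @ekernel_ge0 R a.
have mh c := @measurable_ekernel R a c a0.
have mF := measurable_ekernel2 c1 c2 a0.
have F0 w : (0 <= ekernel a c1 w.1 * ekernel a c2 w.2)%E by rewrite mule_ge0.
have prodE : ((\int[lebesgue_measure \x lebesgue_measure]_w
      (ekernel a c1 w.1 * ekernel a c2 w.2)) =
    (\int[lebesgue_measure]_x ekernel a c1 x) *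
    (\int[lebesgue_measure]_y ekernel a c2 y))%E.
  rewrite fubini_tonelli1//.
  transitivity (\int[lebesgue_measure]_x
      (ekernel a c1 x * \int[lebesgue_measure]_y ekernel a c2 y))%E.
    by apply: eq_integral => x _; rewrite /fubini_F/= ge0_integralZl//; exact: mh.
  by rewrite ge0_integralZr//; [exact: mh|exact: integral_ge0].
rewrite ge0_integral_mscale// prodE.
have -> : (16 / (pi * a) = pi^-1 * (4 / Num.sqrt a * (4 / Num.sqrt a)) :> R).
  rewrite -{1}(sqr_sqrtr (ltW a0)).
  have : 0 < Num.sqrt a by rewrite sqrtr_gt0.
  move: (pi_gt0 R) (Num.sqrt a); move: (@pi R) => P P0 s s0.
  by field; rewrite !gt_eqF.
rewrite [leRHS]EFinM lee_pmul2l ?fin_numE ?lte_fin ?invr_gt0 ?pi_gt0//.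
by rewrite EFinM; apply: lee_pmul; rewrite ?integral_kernel_le//; exact: integral_ge0.
Qed.

(** * Complex modulus and the geometry of the cone *)

Lemma normc_ge0 (R : realType) (z : R[i]) : 0 <= normc z.
Proof. by case: z => x y; rewrite /normc sqrtr_ge0. Qed.

Lemma normr_Re_le_normc (R : realType) (z : R[i]) : `|complex.Re z| <= normc z.
Proof.
by case: z => x y /=; rewrite -sqrtr_sqr ler_wsqrtr// lerDl sqr_ge0.
Qed.

Lemma normr_Im_le_normc (R : realType) (z : R[i]) : `|complex.Im z| <= normc z.
Proof.
by case: z => x y /=; rewrite -sqrtr_sqr ler_wsqrtr// lerDr sqr_ge0.
Qed.

Lemma normc_real (R : realType) (x : R) : normc x%:C = `|x|.
Proof. by rewrite /normc/= expr0n/= addr0 sqrtr_sqr. Qed.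

(** If [|z| < 1/2], then [|z - xi| <= 1 + |z| <= 3 (1 - |z|)]. On a segment from [u],
    [z - xi = (1 - t) (u - xi)] has modulus at most [3/2 (1 - t)], while [1 - |z| >= (1 - t) (1 -
    |u|) >= (1 - t) / 2]. *)
Lemma Gamma_half_normc (R : realType) (xi z : R[i]) : normc xi = 1 ->
  Gamma_half xi z -> normc z < 1 /\ normc (z - xi) <= 3 * (1 - normc z).
Proof.
move=> xi1 [|]; rewrite /disc/=.
  move=> z2; split; first lra.
  have := le_normcD z (- xi); rewrite (normcN xi) xi1 => h; apply: (le_trans h).
  lra.
move=> [u /= u2 [t]]; rewrite /= in_itv/= => /andP[t0 t1] <-.
have zE : (1 - t%:C) * u + t%:C * xi - xi = (1 - t)%:C * (u - xi).
  by rewrite rmorphB rmorph1; ring.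
have zn : normc ((1 - t%:C) * u + t%:C * xi) <= (1 - t) * normc u + t.
  apply: (le_trans (le_normcD _ _)).
  rewrite -(rmorph1 (real_complex R)) -rmorphB !normcM !normc_real xi1 mulr1.
  by rewrite !ger0_norm// subr_ge0 ltW.
have u0 := normc_ge0 u.
have uxi : normc (u - xi) <= normc u + 1.
  by apply: (le_trans (le_normcD _ _)); rewrite (normcN xi) xi1.
rewrite zE normcM normc_real ger0_norm; last by rewrite subr_ge0 ltW.
move: (normc _) zn => w zn.
have : (1 - t) * normc (u - xi) <= (1 - t) * (normc u + 1).
  by rewrite ler_wpM2l// subr_ge0 ltW.
have : (1 - t) * normc u < (1 - t) * 2^-1 by rewrite ltr_pM2l// subr_gt0.
by split; nra.
Qed.

(** * Slow variation of the logarithmic factor *)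

(** As [|1 - z|] ranges up to 2, this is what keeps [1 - ln |1 - z|] away from 0. *)
Lemma ln2_lt1 (R : realType) : ln 2 < 1 :> R.
Proof.
rewrite -ltr_expR lnK ?posrE//; have := @expR_gt1Dx R 1 (oner_neq0 R); lra.
Qed.

(* [ln (b / a) <= (b / a)^e / e], and [1 - ln b] is bounded below. *)
Lemma log_slow_variation (R : realType) (e a b : R) : 0 < e -> 0 < a <= b -> b <= 2 ->
  1 - ln a <= (1 + (e * (1 - ln 2))^-1) * (b / a) `^ e * (1 - ln b).
Proof.
move=> e0 /andP[a0 ab] b2; have b0 := lt_le_trans a0 ab.
have c0 : 0 < 1 - ln 2 :> R by rewrite subr_gt0 ln2_lt1.
have Lb : 1 - ln 2 <= 1 - ln b by rewrite lerD2l lerN2 ler_ln ?posrE.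
have ba1 : 1 <= b / a by rewrite ler_pdivlMr// mul1r.
set w := (b / a) `^ e.
have w1 : 1 <= w by rewrite -(powRr0 (b / a)) ler_powR// ltW.
have w0 := lt_le_trans ltr01 w1.
have lnba : ln b - ln a <= e^-1 * w.
  rewrite -ln_div ?posrE// -[leLHS]mul1r -(mulVf (lt0r_neq0 e0)) -mulrA.
  by rewrite ler_pM2l ?invr_gt0// -ln_powR ltW// ln_sublinear.
have lb0 := lt_le_trans c0 Lb.
have h1 : 1 - ln b <= w * (1 - ln b) by rewrite ler_peMl// ltW.
have h2 : e^-1 * w <= (e * (1 - ln 2))^-1 * w * (1 - ln b).
  rewrite invfM -!mulrA ler_pM2l ?invr_gt0// ler_pdivlMl// mulrC.
  by rewrite ler_pM2l.
have : 1 - ln a = (1 - ln b) + (ln b - ln a) by ring.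
nra.
Qed.

Lemma subr1_ln_gt0 (R : realType) (a : R) : a <= 2 -> 0 < 1 - ln a.
Proof.
(* For [a <= 0] the default value [ln a = 0] still gives a positive difference. *)
move=> a2; rewrite subr_gt0; have [a0|a0] := leP a 0; first by rewrite ln0.
by apply: le_lt_trans (ln2_lt1 R); rewrite ler_ln ?posrE.
Qed.

Lemma powR_inv (R : realType) (x r : R) : 0 <= x -> x^-1 `^ r = x `^ (- r).
Proof. by move=> x0; rewrite -powR_inv1// -powRrM mulN1r. Qed.

Lemma log_power_decay (R : realType) (p : R) : 2 < p ->
  exists2 K : R, 0 <= K & forall a b : R, 0 < a <= b -> b <= 2 ->
    (b * (1 - ln b))^-1 `^ p <=
    K * (a `^ (2 - p) * (1 - ln a) `^ (- p)) * b ^- 2.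
Proof.
move=> p2; have p0 : 0 < p by lra.
(* Chosen so that [e p = p - 2]: the [p]-th power of [(b / a)^e] turns [b^(-p)] into
   [a^(2 - p) b^(-2)]. Positivity of [e] is the condition [p > 2]. *)
pose e := 1 - 2 / p.
have e0 : 0 < e by rewrite subr_gt0 ltr_pdivrMr// mul1r.
pose C := 1 + (e * (1 - ln 2))^-1.
have C0 : 0 <= C.
  by rewrite addr_ge0// invr_ge0 mulr_ge0 ?(ltW e0)// subr_ge0 ltW ?ln2_lt1.
exists (C `^ p); first exact: powR_ge0.
move=> a b ab b2; have := log_slow_variation e0 ab b2; rewrite -/C.
case/andP: ab => a0 ab; have b0 := lt_le_trans a0 ab.
have La := subr1_ln_gt0 (le_trans ab b2); have Lb := subr1_ln_gt0 b2.
move: (1 - ln a) (1 - ln b) La Lb => A B A0 B0 AB.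
have : (b * B)^-1 <= C * (b / a) `^ e * (b^-1 * A^-1).
  rewrite invfM mulrCA ler_pM2l ?invr_gt0//.
  by rewrite ler_pdivlMr// mulrC ler_pdivrMr.
move/(ge0_ler_powR (ltW p0)); rewrite !nnegrE => h.
apply: (le_trans (h _ _)).
- by rewrite invr_ge0 mulr_ge0 ?ltW.
- by rewrite !mulr_ge0 ?powR_ge0 ?invr_ge0 ?(ltW a0) ?(ltW b0) ?(ltW A0).
have ib : 0 <= b^-1 by rewrite invr_ge0 ltW.
have ia : 0 <= a^-1 by rewrite invr_ge0 ltW.
have iA : 0 <= A^-1 by rewrite invr_ge0 ltW.
rewrite !powRM ?mulr_ge0 ?powR_ge0 ?(ltW b0)//.
rewrite -!powRrM !powR_inv ?(ltW a0) ?(ltW b0) ?(ltW A0)//.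
have ep : e * p = p - 2 by rewrite /e; field; rewrite gt_eqF.
rewrite ep (_ : - (p - 2) = 2 - p); last by ring.
rewrite -[b ^- 2]powR_invn ?(ltW b0)//.
have -> : b `^ (- 2%:R) = b `^ (p - 2) * b `^ (- p).
  by rewrite -powRD ?(gt_eqF b0) ?implybT//; congr powR; ring.
rewrite le_eqVlt; apply/orP; left; apply/eqP; ring.
Qed.

(** * Size of the function on the disc *)

Definition log_kernel (R : realType) (z : R[i]) : R[i] :=
  1 / ((1 - z) * clog ((expR 1)%:C / (1 - z))).

Lemma one_sub_neq0 (R : realType) (z : R[i]) : normc z < 1 -> 1 - z != 0.
Proof.
move=> z1; rewrite subr_eq0; apply/eqP => zE.
by rewrite -zE normc1 ltxx in z1.
Qed.

Lemma normc_one_sub_gt0 (R : realType) (z : R[i]) : normc z < 1 ->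
  0 < normc (1 - z).
Proof.
move=> z1; rewrite lt_neqAle normc_ge0 andbT eq_sym.
by apply/eqP => /eq0_normc/eqP; rewrite (negbTE (one_sub_neq0 z1)).
Qed.

Lemma normc_one_sub_le2 (R : realType) (z : R[i]) : normc z < 1 ->
  normc (1 - z) <= 2.
Proof.
by move=> z1; apply: (le_trans (le_normcD _ _)); rewrite normcN normc1; lra.
Qed.

(** The modulus of the logarithm is at least its real part [ln |e / (1 - z)|]. *)
Lemma normc_clog_ge (R : realType) (z : R[i]) : normc z < 1 ->
  1 - ln (normc (1 - z)) <= normc (clog ((expR 1)%:C / (1 - z))).
Proof.
move=> z1; apply: le_trans (le_trans (ler_norm _) (normr_Re_le_normc _)).
rewrite /clog/= normcM normcV normc_real (ger0_norm (expR_ge0 1)).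
by rewrite ln_div ?posrE ?expR_gt0 ?normc_one_sub_gt0// expRK.
Qed.

Lemma normc_clog_gt0 (R : realType) (z : R[i]) : normc z < 1 ->
  0 < normc (clog ((expR 1)%:C / (1 - z))).
Proof.
move=> z1; apply: lt_le_trans (normc_clog_ge z1).
by rewrite subr1_ln_gt0// normc_one_sub_le2.
Qed.

Lemma normc_log_kernel_le (R : realType) (z : R[i]) : normc z < 1 ->
  normc (log_kernel z) <=
  (normc (1 - z) * (1 - ln (normc (1 - z))))^-1.
Proof.
move=> z1; have b0 := normc_one_sub_gt0 z1.
rewrite /log_kernel div1r normcV normcM lef_pV2 ?posrE ?mulr_gt0 ?normc_clog_gt0//.
  by rewrite ler_pM2l// normc_clog_ge.
by rewrite subr1_ln_gt0// normc_one_sub_le2.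
Qed.

(** * The integral over one cone *)

(** [log_power_decay] with [b = |1 - z|] leaves [b^(-2) / (1 - |z|^2)] to integrate, which
    [ekernel_bound] dominates by a product of integral [O(1 / a)]. The constant [M] serves all [xi]
    and [a] at once. *)
Lemma tent_integral_le (R : realType) (p : R) : 2 < p ->
  exists2 M : R, 0 <= M & forall (xi : R[i]) (a : R), normc xi = 1 -> 0 < a ->
    (forall z, Gamma_half xi z -> a <= normc (1 - z)) ->
    (tent_integral p (@log_kernel R) xi <=
    (M * (a `^ (1 - p) * (1 - ln a) `^ (- p)))%:E)%E.
Proof.
move=> p2; have [K K0 HK] := log_power_decay p2.
have pi0 := pi_gt0 R.
exists (K * 192 * 16 / pi); first by rewrite !mulr_ge0// invr_ge0 ltW.
move=> [c1 c2] a xi1 a0 aG.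
pose B := K * (a `^ (2 - p) * (1 - ln a) `^ (- p)) * 192.
have B0 : 0 <= B by rewrite !mulr_ge0 ?powR_ge0.
have F0 w : (0 <= ekernel a c1 w.1 * ekernel a c2 w.2)%E.
  by rewrite mule_ge0 ?ekernel_ge0.
apply: (@le_trans _ _
  (\int[area]_w (B%:E * (ekernel a c1 w.1 * ekernel a c2 w.2)))%E); last first.
  rewrite ge0_integralZl_EFin//; last exact: measurable_ekernel2.
  apply: (@le_trans _ _ (B%:E * (16 / (pi * a))%:E)%E).
    by rewrite lee_pmul ?lee_fin ?integral_area_ekernel_le//; exact: integral_ge0.
  rewrite -EFinM lee_fin.
  have -> : a `^ (1 - p) = a `^ (2 - p) * a^-1.
    rewrite -(powR_inv1 (ltW a0)) -powRD ?(gt_eqF a0) ?implybT//.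
    by congr powR; ring.
  rewrite /B; move: (a `^ _) ((1 - ln a) `^ _) => A L.
  move: pi0; move: (@pi R) => P P0.
  rewrite le_eqVlt; apply/orP; left; apply/eqP; field.
  by rewrite !gt_eqF.
(* The domain grows from the cone to the whole plane, where the product bound has been
   integrated. *)
apply: ge0_le_integral_subset => //; last by move=> w _; rewrite mule_ge0.
move=> [x y] Gxy; pose z := x +i* y.
have Gz : Gamma_half (c1 +i* c2) z := Gxy.
change (0 <= (normc (log_kernel z) `^ p / (1 - normc z ^+ 2))%:E <=
  B%:E * (ekernel a c1 x * ekernel a c2 y))%E.
have [z1 zr] := Gamma_half_normc xi1 Gz.
have ab := aG _ Gz.
have z0 := normc_ge0 z.
have s1 : 1 - normc z <= 1 - normc z ^+ 2.
  by rewrite lerD2l lerN2 expr2 ler_piMr// ltW.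
have s0 : 0 < 1 - normc z ^+ 2 by apply: lt_le_trans s1; rewrite subr_gt0.
have b1 : 1 - normc z <= normc (1 - z).
  have : normc (1 - z + z) <= normc (1 - z) + normc z by exact: le_normcD.
  by rewrite subrK normc1; lra.
have b2 := normc_one_sub_le2 z1.
apply/andP; split.
  by rewrite lee_fin divr_ge0 ?powR_ge0// ltW.
have xr : `|x - c1| <= normc (z - (c1 +i* c2)).
  exact: (normr_Re_le_normc (z - (c1 +i* c2))).
have yr : `|y - c2| <= normc (z - (c1 +i* c2)).
  exact: (normr_Im_le_normc (z - (c1 +i* c2))).
have := @ekernel_bound _ a (normc (1 - z)) _ (1 - normc z ^+ 2) _ _ _ _ a0 xr yr ab.
(* Both bounds follow from [|z - xi| <= 3 (1 - |z|)], because [1 - |z|] is at most [|1 - z|] and at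
   most [1 - |z|^2]. *)
have r3b : normc (z - (c1 +i* c2)) <= 3 * normc (1 - z) by lra.
have r3s : normc (z - (c1 +i* c2)) <= 3 * (1 - normc z ^+ 2) by lra.
move=> /(_ r3b r3s); rewrite /B [(_ * 192)%:E]EFinM -muleA => h; apply: le_trans (lee_wpmul2l _ h); last first.
  by rewrite lee_fin mulr_ge0// mulr_ge0 ?powR_ge0.
rewrite -EFinM lee_fin [leRHS]mulrA ler_pM2r ?invr_gt0//.
apply: le_trans (HK _ _ _ b2); last by rewrite a0.
apply: ge0_ler_powR; rewrite ?nnegrE ?normc_ge0 ?normc_log_kernel_le//.
- lra.
- by rewrite invr_ge0 mulr_ge0 ?normc_ge0// ltW// subr1_ln_gt0.
Qed.

(** * Distance from the point 1 to the cone *)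

(** Up to [pi / 4] the mean value theorem applies with [cos c > cos (pi / 4) >= 2/3]; beyond,
    [sin x >= sin (pi / 4) >= 2/3 >= x / 3] because [x <= pi / 2 < 2]. *)
Lemma sin_ge_third (R : realType) (x : R) : 0 <= x <= pi / 2 -> x / 3 <= sin x.
Proof.
have /andP[p0 p2] := pihalf_02 R; set h : R := pi / 2 in p0 p2 *.
have hpi : h <= pi by rewrite /h; have := pi_gt0 R; lra.
have cos0 : 0 < cos (h / 2) by apply: cos_gt0_pihalf; rewrite -/h; lra.
have sin0' : 0 < sin (h / 2) by apply: sin_gt0_pihalf; rewrite -/h; lra.
have cos2 : cos (h / 2) ^+ 2 = 2^-1.
  have := cos_mulr2n (h / 2); rewrite -[h / 2 *+ 2]mulr_natr divfK// cos_pihalf; lra.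
have sin2 : sin (h / 2) ^+ 2 = 2^-1.
  have := cos2Dsin2 (h / 2); rewrite cos2; lra.
have ge23 (s : R) : 0 < s -> s ^+ 2 = 2^-1 -> 2 / 3 <= s by nra.
case/andP => x0 xh; have [xh2|xh2] := leP x (h / 2); last first.
  apply: (@le_trans _ _ (sin (h / 2))).
    by apply: le_trans (ge23 _ sin0' sin2); lra.
  by apply/ltW; rewrite ltr_sin ?in_itv/= -/h//; apply/andP; split; lra.
move: x0; rewrite le_eqVlt => /predU1P[<-|x0]; first by rewrite mul0r sin0.
have [|c] := @MVT R sin cos 0 x x0 (fun y _ => is_derive_sin y).
  by apply: continuous_subspaceT => y; exact: continuous_sin.
rewrite in_itv/= => /andP[c0 cx]; rewrite sin0 !subr0 => ->.
have : cos (h / 2) < cos c.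
  by rewrite ltr_cos ?in_itv/=; lra.
have := ge23 _ cos0 cos2; nra.
Qed.

Lemma normc_circle (R : realType) (t : R) : normc (cos t +i* sin t) = 1.
Proof. by rewrite /normc/= cos2Dsin2 sqrtr1. Qed.

(** The chord has length [2 |sin (t / 2)|]; for [t > pi] the same bound is applied to [2 pi - t],
    using [sin (pi - s) = sin s]. *)
Lemma chord_ge (R : realType) (t : R) : 0 <= t <= pi *+ 2 ->
  Num.min t (pi *+ 2 - t) / 3 <= normc (1 - (cos t +i* sin t)).
Proof.
move=> /andP[t0 t2]; pose s := t / 2.
have ts : t = s *+ 2 by rewrite -[s *+ 2]mulr_natr divfK.
have -> : normc (1 - (cos t +i* sin t)) = 2 * `|sin s|.
  rewrite /normc/= sub0r sqrrN.
  rewrite -[2]ger0_norm// -normrM -sqrtr_sqr; congr Num.sqrt.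
  rewrite ts cos_mulr2n sin_mulr2n exprMn.
  have := cos2Dsin2 s; move: (cos s) (sin s) => C S CS.
  have SE : S ^+ 2 = 1 - C ^+ 2 by rewrite -CS; ring.
  rewrite -[C * S *+ 2]mulr_natr exprMn exprMn !SE; ring.
have half (u : R) : 0 <= u <= pi -> u / 3 <= 2 * sin (u / 2).
  move=> /andP[u0 u1]; have := @sin_ge_third _ (u / 2); lra.
have [tp|tp] := leP t pi.
  apply: (@le_trans _ _ (t / 3)).
    by rewrite ler_pM2r ?invr_gt0// ge_min lexx.
  apply: (le_trans (half _ _)); first by rewrite t0.
  by rewrite ler_pM2l// ler_norm.
apply: (@le_trans _ _ ((pi *+ 2 - t) / 3)).
  by rewrite ler_pM2r ?invr_gt0// ge_min lexx orbT.
apply: (le_trans (half _ _)); first lra.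
have -> : (pi *+ 2 - t) / 2 = - (s - pi) by rewrite /s; lra.
rewrite sinN sinB cospi sinpi mulr0 subr0 mulrN1 opprK.
by rewrite ler_pM2l// ler_norm.
Qed.

(** [|1 - xi| <= |1 - z| + |z - xi| <= 4 |1 - z|], and the chord bound supplies the remaining factor
    3 of 12. *)
Lemma Gamma_half_circle_ge (R : realType) (t : R) (z : R[i]) : 0 <= t <= pi *+ 2 ->
  Gamma_half (cos t +i* sin t) z ->
  Num.min t (pi *+ 2 - t) / 12 <= normc (1 - z).
Proof.
move=> t02 Gz; have [z1 zr] := Gamma_half_normc (normc_circle t) Gz.
have := chord_ge t02; set xi := cos t +i* sin t in zr *.
have b1 : 1 - normc z <= normc (1 - z).
  have : normc (1 - z + z) <= normc (1 - z) + normc z by exact: le_normcD.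
  by rewrite subrK normc1; lra.
have : normc (1 - z + (z - xi)) <= normc (1 - z) + normc (z - xi) by exact: le_normcD.
rewrite addrA subrK; lra.
Qed.

(** * The boundary integral *)

(** Denominators start at 3 so that [T / n.+3%:R < T / 2] and every interval has distinct endpoints,
    as [integral_antideriv_le] demands. *)
Lemma bigcup_itv_oo (R : realType) (T : R) : 0 < T ->
  [set t | 0 < t < T] =
  \bigcup_n `[T / n.+3%:R, T - T / n.+3%:R]%classic.
Proof.
move=> T0; have i0 (n : nat) : 0 < T / n.+3%:R by rewrite divr_gt0.
apply/seteqP; split=> [t /= /andP[t0 tT]|t [n _] /=]; last first.
  rewrite in_itv/= => /andP[t1 t2]; have := i0 n; move: (T / _) t1 t2 => u; lra.
have key (s : R) : 0 < s -> exists n : nat, forall m : nat, (n <= m)%N -> T / m.+3%:R <= s.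
  move=> s0; exists (Num.truncn (T / s)) => m nm.
  rewrite ler_pdivrMr// mulrC -ler_pdivrMr//; apply/ltW/(lt_le_trans (truncnS_gt _)).
  by rewrite ler_nat ltnS (leq_trans nm)// leqW.
have [n1 h1] := key _ t0.
have [n2 h2] := key (T - t) (ltac:(by rewrite subr_gt0)).
exists (n1 + n2)%N => //=; rewrite in_itv/= h1 ?leq_addr//=.
by rewrite lerBrDr -lerBrDl h2 ?leq_addl.
Qed.

Lemma is_derive_log12 (R : realType) (t : R) : 0 < t -> is_derive t 1 (fun s : R => 1 - ln (s / 12)) (- t^-1).
Proof.
move=> t0; have t12 : 0 < t / 12 by rewrite divr_gt0.
have d1 : is_derive t 1 (fun s : R => s / 12) 12^-1.
  rewrite (_ : (fun s : R => s / 12) = 12^-1 *: id); last first.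
    by apply/funext => s; rewrite mulrC.
  apply: (is_derive_eq (is_deriveZ 12^-1 (is_derive_id t 1))).
  by rewrite /GRing.scale/= mulr1.
have d2 := @is_derive1_comp _ (@ln R) (fun s => s / 12) _ _ _ (is_derive1_ln t12) d1.
have d3 := is_deriveB (is_derive_cst (1 : R) t 1) d2.
rewrite (_ : - t^-1 = 0 - (t / 12)^-1 / 12); first exact: d3.
by field; rewrite gt_eqF.
Qed.

Lemma log12_ge1 (R : realType) (t : R) : 0 < t <= 12 -> 1 <= 1 - ln (t / 12).
Proof.
move=> /andP[t0 t12]; rewrite lerDl oppr_ge0 ln_le0//.
by rewrite ler_pdivrMr// mul1r.
Qed.

Lemma is_derive_log12_powR (R : realType) (r t : R) : 0 < t <= 12 ->
  is_derive t 1 (fun s : R => (1 - ln (s / 12)) `^ r)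
    (r * (1 - ln (t / 12)) `^ (r - 1) * - t^-1).
Proof.
move=> /[dup] t12 /andP[t0 _].
exact: (@is_derive1_comp _ (fun x => x `^ r) (fun s => 1 - ln (s / 12)) _ _ _
  (is_derive1_powR r (lt_le_trans ltr01 (log12_ge1 t12))) (is_derive_log12 t0)).
Qed.

(** This is [a^(-1) L(a)^(-q)] at [a = t / 12]. *)
Definition bdry_kernel (R : realType) (q t : R) : R := 12 / t * (1 - ln (t / 12)) `^ (- q).

Definition bdry_prim (R : realType) (q t : R) : R := 12 / (q - 1) * (1 - ln (t / 12)) `^ (1 - q).

Lemma bdry_kernel_ge0 (R : realType) (q t : R) : 0 < t -> 0 <= bdry_kernel q t.
Proof. by move=> t0; rewrite mulr_ge0 ?powR_ge0// divr_ge0// ltW. Qed.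

Lemma is_derive_bdry_prim (R : realType) (q t : R) : 1 < q -> 0 < t <= 12 -> is_derive t 1 (bdry_prim q) (bdry_kernel q t).
Proof.
move=> q1 t12; apply: (is_derive_eq (is_deriveZ (12 / (q - 1)) (is_derive_log12_powR (1 - q) t12))).
rewrite /GRing.scale/= /bdry_kernel (_ : 1 - q - 1 = - q); last by ring.
case/andP: t12 => t0 _; move: (_ `^ _) => A; field.
by rewrite !gt_eqF// subr_gt0.
Qed.

Lemma continuous_bdry_kernel (R : realType) (q t : R) : 0 < t <= 12 -> {for t, continuous (bdry_kernel q)}.
Proof.
move=> /[dup] t12 /andP[t0 _]; rewrite /continuous_at /bdry_kernel.
apply: cvgM.
  by apply: cvgM; [exact: cvg_cst|apply: cvgV; rewrite ?gt_eqF//; exact: cvg_id].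
have [d _] := is_derive_log12_powR (- q) t12.
have c : {for t, continuous (fun s : R => (1 - ln (s / 12)) `^ (- q))}.
  exact/differentiable_continuous/derivable1_diffP.
exact: c.
Qed.

(** Integrability at 0 rests on this: [q > 1] makes the exponent [1 - q] negative, and the base is
    at least 1, so the power stays at most 1. *)
Lemma bdry_prim_bound (R : realType) (q t : R) : 1 < q -> 0 < t <= 12 -> 0 <= bdry_prim q t <= 12 / (q - 1).
Proof.
move=> q1 t12; have c0 : 0 <= 12 / (q - 1) by rewrite divr_ge0// subr_ge0 ltW.
rewrite /bdry_prim mulr_ge0 ?powR_ge0//= ler_piMr//.
rewrite -[leRHS](powRr0 (1 - ln (t / 12))) ler_powR ?log12_ge1//; lra.
Qed.

(** Both ends of the interval are singular. Reflecting [t] to [T - t] changes the sign of the second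
    primitive, and the increments of [F] are at most twice [12 M / (q - 1)]. *)
Lemma integral_bdry_kernel_lty (R : realType) (q M T : R) : 1 < q -> 0 <= M -> 0 < T <= 12 ->
  (\int[lebesgue_measure]_(t in [set t | (0 < t < T)%R])
     (M * (bdry_kernel q t + bdry_kernel q (T - t)))%:E < +oo)%E.
Proof.
move=> q1 M0 /andP[T0 T12]; rewrite bigcup_itv_oo//.
pose F t := M * (bdry_prim q t - bdry_prim q (T - t)).
have i0 (n : nat) : 0 < T / n.+3%:R by rewrite divr_gt0.
have i2 (n : nat) : T / n.+3%:R < T / 2.
  by rewrite ltr_pM2l// ltf_pV2 ?posrE// ltr_nat.
have i_le (m n : nat) : (m <= n)%N -> T / n.+3%:R <= T / m.+3%:R.
  by move=> mn; rewrite ler_pM2l// lef_pV2 ?posrE// ler_nat !ltnS.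
apply: (@le_lt_trans _ _ (M * (12 / (q - 1) + 12 / (q - 1)))%:E); last exact: ltry.
apply: (@integral_antideriv_le _ _ F).
- by move=> n; have := i2 n; move: (T / n.+3%:R) => u; lra.
- by move=> m n /i_le.
- by move=> m n /i_le; rewrite lerD2l lerN2.
- move=> n t; have := i0 n; move: (T / n.+3%:R) => u u0 tu.
  have t12 : 0 < t <= 12 by lra.
  have Tt12 : 0 < T - t <= 12 by lra.
  have dB : is_derive t 1 (fun s => T - s) (- 1).
    by have := is_deriveB (is_derive_cst T t 1) (is_derive_id t 1); rewrite sub0r.
  split.
  + by rewrite mulr_ge0// addr_ge0// bdry_kernel_ge0//; lra.
  + apply: cvgM; first exact: cvg_cst.
    apply: cvgD; first exact: continuous_bdry_kernel.
    apply: (@continuous_comp _ _ _ (fun s => T - s) (bdry_kernel q)).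
      by apply: cvgB; [exact: cvg_cst|exact: cvg_id].
    exact: continuous_bdry_kernel.
  + have d2 := @is_derive1_comp _ (bdry_prim q) (fun s => T - s) _ _ _
      (is_derive_bdry_prim q1 Tt12) dB.
    apply: (is_derive_eq (is_deriveZ M (is_deriveB (is_derive_bdry_prim q1 t12) d2))).
    by rewrite /GRing.scale/= mulrN1 opprK.
- move=> n; rewrite /F -mulrBr ler_wpM2l//.
  have := i0 n; have := i2 n; move: (T / n.+3%:R) => u u2 u0.
  have /andP[] : 0 <= bdry_prim q (T - u) <= 12 / (q - 1) by apply: bdry_prim_bound => //; lra.
  have /andP[] : 0 <= bdry_prim q u <= 12 / (q - 1) by apply: bdry_prim_bound => //; lra.
  rewrite (_ : T - (T - u) = u); last by ring.
  lra.
Qed.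


(** * Finiteness of the tent norm *)

Lemma tent_integral_ge0 (R : realType) (p : R) (f : R[i] -> R[i]) (xi : R[i]) :
  normc xi = 1 -> (0 <= tent_integral p f xi)%E.
Proof.
move=> xi1; apply: integral_ge0 => w Gw.
have [z1 _] := Gamma_half_normc xi1 Gw.
rewrite lee_fin divr_ge0 ?powR_ge0// subr_ge0 expr_le1 ?normc_ge0//.
exact: ltW.
Qed.

Lemma tent_norm_log_kernel_lty (R : realType) (p q : R) : 1 < q ->
  1 / p + 1 / q = 1 -> 2 < p -> (tent_norm q p (@log_kernel R) < +oo)%E.
Proof.
move=> q1 pq p2; have p0 : 0 < p by lra.
have q0 : 0 < q by lra.
(* Conjugacy gives [p + q = p q], so the power [q / p] turns [a^(1 - p)] into exactly [a^(-1)]. *)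
have pqE : (1 - p) * (q / p) = - 1.
  have : p + q = p * q.
    by rewrite -[RHS]mulr1 -pq; field; rewrite !gt_eqF.
  move=> h; apply: (@mulIf _ p); first by rewrite gt_eqF.
  by rewrite -mulrA divfK ?gt_eqF//; lra.
have [M M0 HM] := tent_integral_le p2.
set T : R := pi *+ 2; have pi0 := pi_gt0 R.
have T0 : 0 < T by rewrite mulrn_wgt0.
(* From [pi / 2 < 2]. It places [T] below 12, so that [1 - ln (t / 12) >= 1] on the whole
   interval. *)
have T8 : T <= 8.
  have /andP[_] := pihalf_02 R; rewrite /T -mulr_natr; lra.
pose f t := M `^ (q / p) * (bdry_kernel q t + bdry_kernel q (T - t)).
have f0 t : 0 < t < T -> 0 <= f t.
  move=> /andP[t0 tT]; rewrite mulr_ge0 ?powR_ge0// addr_ge0// bdry_kernel_ge0//.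
  by rewrite subr_gt0.
apply: poweR_lty.
(* At [t = 0] the vertex is 1 and the lower bound [a] degenerates to 0, so the majorant takes the
   value [+oo] there. *)
apply: (@le_lt_trans _ _ (\int[lebesgue_measure]_(t in 0%R |` [set t | (0 < t < T)%R])
   (if t == 0%R then +oo else (f t)%:E))%E); last first.
  rewrite integral_pinfty_point//.
  - apply: integral_bdry_kernel_lty => //; first exact: powR_ge0.
    by rewrite T0; lra.
  - rewrite (_ : [set t | _] = `]0, T[%classic); first exact: itv_open.
    by apply/seteqP; split => t /=; rewrite in_itv.
  - by move=> /=; rewrite ltxx.
  - move=> t /set_mem/= /andP[t0 tT].
    apply: cvgM; first exact: cvg_cst.
    apply: cvgD; first by apply: continuous_bdry_kernel; lra.
    apply: (@continuous_comp _ _ _ (fun s => T - s) (bdry_kernel q)).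
      by apply: cvgB; [exact: cvg_cst|exact: cvg_id].
    by apply: continuous_bdry_kernel; lra.
apply: ge0_le_integral_subset.
- move=> t /=; rewrite in_itv/= -/T => /andP[+ tT]; rewrite le_eqVlt.
  by move=> /predU1P[<-|t0]; [left|right; rewrite /= t0].
- move=> t; rewrite /= in_itv/= -/T => /andP[t0 tT].
  rewrite poweR_ge0/=; case: eqVneq => [_|tn0]; first by rewrite leey.
  have {tn0}t0 : 0 < t by rewrite lt_neqAle eq_sym tn0.
  pose a := Num.min t (T - t) / 12.
  have a0 : 0 < a by rewrite divr_gt0// lt_min t0 subr_gt0.
  have a2 : a <= 2.
    rewrite ler_pdivrMr// ge_min; apply/orP; left; lra.
  have t02 : 0 <= t <= pi *+ 2 by rewrite (ltW t0) (ltW tT).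
  have := HM _ _ (normc_circle t) a0 (fun z Gz => Gamma_half_circle_ge t02 Gz).
  have La := subr1_ln_gt0 a2.
  have tent0 : (0 <= tent_integral p (@log_kernel R) (cos t +i* sin t))%E.
    apply: tent_integral_ge0; exact: normc_circle.
  move=> /(gt0_ler_poweR (ltW (divr_gt0 q0 p0))) => h.
  apply: (le_trans (h _ _)).
  + by rewrite in_itv/= tent0 leey.
  + by rewrite in_itv/= leey lee_fin !mulr_ge0// powR_ge0.
  rewrite poweR_EFin lee_fin /f powRM ?mulr_ge0 ?powR_ge0//.
  rewrite ler_wpM2l ?powR_ge0// powRM ?powR_ge0// -!powRrM pqE.
  rewrite (_ : - p * (q / p) = - q); last by field; rewrite gt_eqF.
  rewrite powR_inv1 ?(ltW a0)//.
  have aE s : a = s / 12 -> a^-1 * (1 - ln a) `^ (- q) = bdry_kernel q s.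
    by move=> ->; rewrite /bdry_kernel invf_div.
  have kt := bdry_kernel_ge0 q t0.
  have kTt : 0 <= bdry_kernel q (T - t) by rewrite bdry_kernel_ge0// subr_gt0.
  (* The smaller of [t] and [T - t] determines [a]; its kernel is one summand and the other summand
     is nonnegative. *)
  have [tT2|tT2] := leP t (T - t).
    by rewrite (aE t) ?lerDl// /a min_l.
  by rewrite (aE (T - t)) ?lerDr// /a min_r// ltW.
- move=> t [->|tT]; first by rewrite eqxx leey.
  by case: ifP => _; rewrite ?leey// lee_fin f0.
Qed.

(** * Analyticity of the function on the disc *)

(** With [theta = atan (y / x)], [x / |x + i y| = cos theta], and [theta] has the sign of [y]; hence
    both branches of [carg] return [theta]. *)
Lemma carg_atan (R : realType) (x y : R) : 0 < x -> carg (x +i* y) = atan (y / x).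
Proof.
move=> x0; have xE : x / normc (x +i* y) = cos (atan (y / x)).
  have sE : 1 + (y / x) ^+ 2 = x ^- 2 * (x ^+ 2 + y ^+ 2).
    by field; rewrite gt_eqF.
  rewrite cos_atan /normc sE sqrtrM ?invr_ge0 ?sqr_ge0// sqrtrV ?sqr_ge0//.
  by rewrite sqrtr_sqr gtr0_norm// invfM invrK.
have lb := atan_gtNpi2 (y / x); have ub := atan_ltpi2 (y / x).
have p0 := pi_gt0 R.
rewrite /carg /= -/(normc (x +i* y)) xE; case: ifPn => [y0|].
  have : 0 <= atan (y / x) by rewrite -(atan0 R) le_atan// divr_ge0// ltW.
  by move=> a0; rewrite cosK// in_itv/=; lra.
rewrite -ltNge => y0.
have : atan (y / x) <= 0.
  by rewrite -[leRHS](atan0 R) le_atan// pmulr_lle0 ?invr_gt0// ltW.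
by move=> a0; rewrite cosKN ?opprK//; lra.
Qed.

(** [e / (1 - z)] is a positive multiple of the conjugate of [1 - z], so it lies in the right
    half-plane, where [carg_atan] applies. *)
Lemma clog_exp1_div (R : realType) (x y : R) : x < 1 ->
  clog ((expR 1)%:C / (1 - (x +i* y))) =
  (1 - ln ((1 - x) ^+ 2 + y ^+ 2) / 2) +i* atan (y / (1 - x)).
Proof.
move=> x1; have p0 : 0 < 1 - x by rewrite subr_gt0.
have N0 : 0 < (1 - x) ^+ 2 + y ^+ 2 by rewrite ltr_pwDl ?exprn_gt0 ?sqr_ge0.
have e0 := expR_gt0 (1 : R).
congr Complex.
  rewrite normcM normcV normc_real gtr0_norm//= sub0r sqrrN.
  rewrite ln_div ?posrE ?sqrtr_gt0// expRK -powR12_sqrt ?(ltW N0)// ln_powR.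
  by rewrite mulrC.
have -> : (expR 1)%:C / (1 - (x +i* y)) =
    (expR 1 * (1 - x) / ((1 - x) ^+ 2 + y ^+ 2)) +i*
    (expR 1 * y / ((1 - x) ^+ 2 + y ^+ 2)).
  by apply/eqP; rewrite eq_complex/= sub0r sqrrN; apply/andP; split; apply/eqP;
    field; rewrite gt_eqF.
rewrite carg_atan ?divr_gt0 ?mulr_gt0//; congr atan.
by field; rewrite !gt_eqF.
Qed.

Lemma is_derive_approx (R : realType) (f : R -> R) (a d e : R) :
  is_derive a 1 f d -> 0 < e ->
  exists2 r : R, 0 < r & forall x, `|x - a| < r ->
    `|f x - f a - d * (x - a)| <= e * `|x - a|.
Proof.
move=> [df dE] e0; have : (fun h : R => h^-1 *: (f (h *: 1 + a) - f a)) @ 0^' --> d.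
  by rewrite -dE; exact: df.
move=> /cvgrPdist_lt /(_ _ e0) /nbhs_ballP[r /= r0 H]; exists r => // x xr.
have [->|xa] := eqVneq x a; first by rewrite !subrr mulr0 subr0 normr0 mulr0.
have h0 : x - a != 0 by rewrite subr_eq0.
have := H (x - a); rewrite /ball/= sub0r normrN => /(_ xr h0).
rewrite /GRing.scale/= mulr1 subrK => /ltW h.
rewrite (_ : f x - f a - d * (x - a) =
  - ((d - (x - a)^-1 * (f x - f a)) * (x - a))); last by field.
by rewrite normrN normrM ler_wpM2r.
Qed.

(* With [1 - z = x - i y] and [k = k1 + i k2], [|k| = n]: the two terms are the
   real and imaginary parts of [log (e / (1 - z - k)) - log (e / (1 - z)) -
   k / (1 - z)]. *)
Lemma log_exp1_div_approx (R : realType) (x y e : R) :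
  0 < x <= 2 -> `|y| <= 1 -> 0 < e ->
  exists2 d : R, 0 < d & forall k1 k2 n : R,
    `|k1| <= n -> `|k2| <= n -> k1 ^+ 2 + k2 ^+ 2 = n ^+ 2 -> n < d ->
    k1 < x /\
    `|- (ln ((x - k1) ^+ 2 + (y + k2) ^+ 2) - ln (x ^+ 2 + y ^+ 2)) / 2
      - (x * k1 - y * k2) / (x ^+ 2 + y ^+ 2)|
    + `|atan ((y + k2) / (x - k1)) - atan (y / x)
      - (x * k2 + y * k1) / (x ^+ 2 + y ^+ 2)| <= e * n.
Proof.
move=> /andP[x0 x2] y1 e0; have x20 : 0 < x ^+ 2 by rewrite exprn_gt0.
set N := x ^+ 2 + y ^+ 2; have N0 : 0 < N by rewrite ltr_pwDl ?sqr_ge0.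
(* [Q] collects the first-order errors, [7/2 <= 4] from [ln] and [6 / x^2] from [atan]; [W] collects
   the coefficients of [n^2]. *)
pose Q := 4 + 6 / x ^+ 2; pose W := (1 + 6 / x) / N.
have Q0 : 0 < Q by rewrite addr_gt0// divr_gt0.
have W0 : 0 < W by rewrite divr_gt0// addr_gt0// divr_gt0.
pose e1 := e / 2 / Q; have e10 : 0 < e1 by rewrite !divr_gt0.
have [r1 r10 H1] := is_derive_approx (is_derive1_ln N0) e10.
have [r2 r20 H2] := is_derive_approx (is_derive1_atan (y / x)) e10.
(* In order: [n^2 <= n]; [x - k1 > x / 2]; the increments of the arguments of [ln] and [atan] stay
   below [r1] and [r2]; [n W <= e / 2]. *)
pose d := Num.min (Num.min 1 (x / 2)) (Num.min (Num.min (r1 / 7) (r2 * x ^+ 2 / 6)) (e / 2 / W)).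
exists d.
  have r30 : 0 < r2 * x ^+ 2 by rewrite mulr_gt0.
  have e20 : 0 < e / 2 by rewrite divr_gt0.
  by rewrite !lt_min ltr01 (divr_gt0 x0)// (divr_gt0 r10)// (divr_gt0 r30)// divr_gt0.
move=> k1 k2 n k1n k2n nE; rewrite !lt_min => /andP[/andP[n1 nx]].
move=> /andP[/andP[nr1 nr2] nW].
have n0 : 0 <= n by apply: le_trans k1n.
have /andP[k1l k1u] : - n <= k1 <= n by rewrite -ler_norml.
have /andP[k2l k2u] : - n <= k2 <= n by rewrite -ler_norml.
have /andP[yl yu] : - 1 <= y <= 1 by rewrite -ler_norml.
have xk : x / 2 < x - k1 by lra.
have xk0 : 0 < x - k1 by lra.
split; first lra.
have xyk : `|x * k1| <= 2 * n /\ `|y * k2| <= n /\ `|x * k2| <= 2 * n /\ `|y * k1| <= n.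
  have x0' := ltW x0.
  rewrite !normrM (ger0_norm x0'); split; first by rewrite ler_pM.
  split; first by rewrite -[leRHS]mul1r ler_pM.
  by split; [rewrite ler_pM|rewrite -[leRHS]mul1r ler_pM].
case: xyk => /[!ler_norml]/andP[a1 a2] [/andP[b1 b2]] [/andP[c1 c2]] /andP[d1 d2].
have nn : n ^+ 2 <= n by rewrite expr2 ler_piMr// ltW.
have DNE : (x - k1) ^+ 2 + (y + k2) ^+ 2 - N = - 2 * (x * k1) + 2 * (y * k2) + n ^+ 2.
  by rewrite /N -nE; ring.
have n20 : 0 <= n ^+ 2 by rewrite sqr_ge0.
have DN : `|(x - k1) ^+ 2 + (y + k2) ^+ 2 - N| <= 7 * n.
  by rewrite DNE ler_norml; apply/andP; split; lra.
have DAE : (y + k2) / (x - k1) - y / x = (x * k2 + y * k1) / (x * (x - k1)).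
  by field; rewrite !gt_eqF.
have num3 : `|x * k2 + y * k1| <= 3 * n by rewrite ler_norml; apply/andP; split; lra.
have DA : `|(y + k2) / (x - k1) - y / x| <= 6 / x ^+ 2 * n.
  rewrite DAE normrM normfV (gtr0_norm (mulr_gt0 x0 xk0)) ler_pdivrMr ?mulr_gt0//.
  apply: (le_trans num3).
  rewrite (_ : 6 / _ * n * _ = 3 * n * ((x - k1) / (x / 2))); last first.
    by field; rewrite gt_eqF.
  by rewrite ler_peMr ?mulr_ge0// ler_pdivlMr ?divr_gt0// mul1r ltW.
have E1 : `|ln ((x - k1) ^+ 2 + (y + k2) ^+ 2) - ln N -
    N^-1 * ((x - k1) ^+ 2 + (y + k2) ^+ 2 - N)| <= e1 * (7 * n).
  apply: le_trans (H1 _ _) _; last by rewrite ler_pM2l.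
  by apply: (le_lt_trans DN); lra.
have E2 : `|atan ((y + k2) / (x - k1)) - atan (y / x) -
    (1 + (y / x) ^+ 2)^-1 * ((y + k2) / (x - k1) - y / x)| <= e1 * (6 / x ^+ 2 * n).
  apply: le_trans (H2 _ _) _; last by rewrite ler_pM2l.
  by apply: (le_lt_trans DA); rewrite mulrAC ltr_pdivrMr// mulrC -ltr_pdivlMr.
have F2 : `|(x * k2 + y * k1) / N * (k1 / (x - k1))| <= 6 / x / N * n * n.
  rewrite !normrM !normfV (gtr0_norm N0) (gtr0_norm xk0).
  apply: (@le_trans _ _ (3 * n / N * (n / (x / 2)))).
    apply: ler_pM; rewrite ?mulr_ge0 ?invr_ge0 ?(ltW N0) ?(ltW xk0)//.
      by rewrite ler_pM2r ?invr_gt0.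
    by apply: ler_pM; rewrite ?invr_ge0 ?(ltW xk0)// lef_pV2 ?posrE ?divr_gt0 ?(ltW xk).
  rewrite le_eqVlt; apply/orP; left; apply/eqP.
  by field; rewrite !gt_eqF.
set L := ln _ - ln N in E1 *.
set A := atan _ - atan _ in E2 *.
(* The increment of the squared modulus is its linear part plus [n^2], whence the remainder
   [n^2 / (2 N)]. *)
have -> : - L / 2 - (x * k1 - y * k2) / N =
   - (L - N^-1 * ((x - k1) ^+ 2 + (y + k2) ^+ 2 - N)) / 2 - n ^+ 2 / (2 * N).
  by rewrite DNE; field; rewrite gt_eqF.
(* The derivative of [atan] yields the linear term times [x / (x - k1) = 1 + k1 / (x - k1)]; the
   excess is of second order in [n]. *)
have -> : A - (x * k2 + y * k1) / N =
   A - (1 + (y / x) ^+ 2)^-1 * ((y + k2) / (x - k1) - y / x) +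
   (x * k2 + y * k1) / N * (k1 / (x - k1)).
  rewrite DAE /N; field.
  by rewrite -/N !gt_eqF.
have F1 : `|n ^+ 2 / (2 * N)| <= n / N * n.
  rewrite ger0_norm ?divr_ge0 ?mulr_ge0 ?(ltW N0)//.
  rewrite (_ : n / N * n = 2 * (n ^+ 2 / (2 * N))).
    by rewrite ler_peMl ?divr_ge0 ?mulr_ge0 ?(ltW N0)// ler1n.
  by field; rewrite gt_eqF.
have G1 : e1 * Q = e / 2 by rewrite /e1 divfK ?gt_eqF.
have G2 : n * W <= e / 2 by rewrite -ler_pdivlMr// ltW.
apply: (@le_trans _ _ (e1 * (7 * n) / 2 + n / N * n + (e1 * (6 / x ^+ 2 * n) + 6 / x / N * n * n))).
  apply: lerD.
    apply: (le_trans (ler_normB _ _)); rewrite lerD//.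
    by rewrite normrM normrN normfV (ger0_norm (ler0n _ 2)) ler_pM2r.
  by apply: (le_trans (ler_normD _ _)); rewrite lerD.
have -> : e * n = (e1 * Q) * n + (e / 2) * n by rewrite G1; field.
have H : n * W * n <= e / 2 * n by rewrite ler_wpM2r.
apply: le_trans (lerD (lexx _) H).
rewrite (_ : e1 * Q * n = e1 * 4 * n + e1 * (6 / x ^+ 2 * n)); last by rewrite /Q; ring.
rewrite (_ : n * W * n = n / N * n + 6 / x / N * n * n); last by rewrite /W; ring.
have := mulr_ge0 (ltW e10) n0; lra.
Qed.

Lemma normc_le_Re_Im (R : realType) (x y : R) : normc (x +i* y) <= `|x| + `|y|.
Proof.
rewrite /normc -ler_sqr ?nnegrE ?sqrtr_ge0 ?addr_ge0//.
rewrite sqr_sqrtr ?addr_ge0 ?sqr_ge0// sqrrD !real_normK ?num_real//.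
by rewrite addrAC lerDl mulrn_wge0// mulr_ge0.
Qed.

Lemma clog_exp1_div_approx (R : realType) (z : R[i]) (e : R) :
  normc z < 1 -> 0 < e ->
  exists2 d : R, 0 < d & forall k : R[i], normc k < d ->
    normc (clog ((expR 1)%:C / (1 - (z + k))) - clog ((expR 1)%:C / (1 - z))
      - k / (1 - z)) <= e * normc k.
Proof.
case: z => a b z1 e0.
have /= aN := normr_Re_le_normc (a +i* b); have /= bN := normr_Im_le_normc (a +i* b).
have a1 : `|a| < 1 by exact: le_lt_trans z1.
have b1 : `|b| <= 1 by apply: (le_trans bN); exact: ltW.
have /andP[al au] : - 1 < a < 1 by rewrite -ltr_norml.
have x02 : 0 < 1 - a <= 2 by lra.
have [d d0 H] := log_exp1_div_approx x02 b1 e0.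
exists d => // -[k1 k2] kd.
have [|ka {}H] := H k1 k2 _ (normr_Re_le_normc (k1 +i* k2))
    (normr_Im_le_normc (k1 +i* k2)) _ kd.
  by rewrite /normc sqr_sqrtr// addr_ge0 ?sqr_ge0.
apply: le_trans H; rewrite (clog_exp1_div b au).
have ak1 : a + k1 < 1 by lra.
rewrite (clog_exp1_div (b + k2) ak1 : clog (_ / (1 - (a +i* b + (k1 +i* k2)))) = _).
have N0 : 0 < (1 - a) ^+ 2 + b ^+ 2.
  by case/andP: x02 => x0 _; rewrite ltr_pwDl ?exprn_gt0 ?sqr_ge0.
apply: le_trans (normc_le_Re_Im _ _).
rewrite le_eqVlt; apply/orP; left; apply/eqP; congr normc.
apply/eqP; rewrite eq_complex/= !sub0r sqrrN opprD addrA.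
apply/andP; split; apply/eqP; field; rewrite gt_eqF//.
Qed.

Lemma derivable_clog_exp1_div (R : realType) (z : R[i]) : normc z < 1 ->
  derivable ((fun w : R[i] => clog ((expR 1)%:C / (1 - w))) : R[i]^o -> R[i]^o) z 1.
Proof.
move=> z1; apply/cvg_ex; exists ((1 - z)^-1 : R[i]^o).
(* In [R[i]], [0 < e1 +i* e2] means [e2 = 0] and [0 < e1], so the estimate becomes one between
   reals. *)
apply/cvgrPdist_le => -[e1 e2] /[dup] e0; rewrite ltcE/= => /andP[/eqP e20 e10].
have [d d0 H] := clog_exp1_div_approx z1 e10.
have d0' : 0 < d%:C :> R[i] by rewrite ltcR.
apply/nbhs_ballP; exists d%:C => //= k kd' k0.
have kd : normc k < d.
  by move: kd'; rewrite /ball/= sub0r normrN -ltcR.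
have n0 : 0 < normc k.
  rewrite lt_neqAle normc_ge0 andbT eq_sym; apply/eqP => /eq0_normc /eqP.
  by rewrite (negbTE k0).
rewrite e20; change ((normc ((1 - z)^-1 - k^-1 * (clog ((expR 1)%:C / (1 - (k * 1 + z)))
   - clog ((expR 1)%:C / (1 - z)))))%:C <= e1%:C).
rewrite lecR mulr1 (addrC k) -(ler_pM2r n0) -normcM.
apply: le_trans (H _ kd); rewrite -[leLHS]normcN.
rewrite le_eqVlt; apply/orP; left; apply/eqP; congr normc.
by field; rewrite k0 one_sub_neq0.
Qed.

(** The function is the reciprocal of a product of derivable functions; the logarithm does not
    vanish, as its modulus is at least [1 - ln |1 - z| > 0]. *)
Lemma log_kernel_analytic (R : realType) : analytic_on (disc 1) (@log_kernel R).
Proof.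
move=> z z1; rewrite /disc/= in z1.
have dz : derivable ((fun w : R[i] => 1 - w) : R[i]^o -> R[i]^o) z 1.
  by apply: derivableB; [exact: derivable_cst|exact: derivable_id].
have dl := derivable_clog_exp1_div z1.
have dM := derivableM dz dl.
rewrite (_ : @log_kernel R = (fun w => ((1 - w) * clog ((expR 1)%:C / (1 - w)))^-1)).
  apply: (derivableV _ dM).
  apply/eqP => /(congr1 (@normc R)); rewrite normc0 normcM => /eqP.
  rewrite mulf_eq0 !gt_eqF ?normc_clog_gt0//; exact: normc_one_sub_gt0.
by apply/funext => w; rewrite /log_kernel div1r.
Qed.

Unset Implicit Arguments.

Theorem proposition1p1 (R : realType) (p q : R) (hp : 1 < p) (hq : 1 < q)
    (hpq : 1 / p + 1 / q = 1) (hp2 : 2 < p) :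
  analytic_tent q p
    (fun z : R[i] => 1 / ((1 - z) * clog ((expR 1)%:C / (1 - z)))).
Proof.
split; first exact: log_kernel_analytic.
exact: tent_norm_log_kernel_lty hq hpq hp2.
Qed.
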